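(* For each integer $n\ge 4$, $\psi_0(n)=\psi_n(n)=1$.
   Context: The wheel $W_n$ is the join of the cycle $C_n$ (the outer cycle) and a single vertex: $V(W_n)=\{v,v_1,\dots,v_n\}$ and $E(W_n)=\{vv_i,\ v_iv_{i+1} : 1\le i\le n\}$ with subscripts modulo $n$; the outer cycle $C_n$ has edges $v_iv_{i+1}$. A signed graph $\Sigma=(G,\sigma)$ is a graph $G$ together with a function $\sigma:E(G)\to\{+1,-1\}$; an edge $e$ is negative if $\sigma(e)=-1$. Switching $\Sigma$ at a vertex $u$ changes the sign of every edge incident to $u$. Two signed graphs are isomorphic if there is a graph isomorphism between their underlying graphs preserving edge signs. Two signed graphs are switching isomorphic if one is isomorphic to a signed graph obtained from the other by a sequence of switchings. $(W_n,\sigma)^o$ denotes a signed wheel all of whose negative edges lie on the outer cycle $C_n$. For $0\le p\le n$, $\psi_p(n)$ denotes the number of switching non-isomorphic signed wheels of the form $(W_n,\sigma)^o$ with exactly $p$ negative edges (the number of equivalence classes of such signed wheels under switching isomorphism). *)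

(* Defs.v *)
From mathcomp Require Import all_boot.

Set Implicit Arguments.
Unset Strict Implicit.
Unset Printing Implicit Defensive.

Record sgraph := SGraph {
  vertex :> finType;
  adj : rel vertex;
  adj_sym : symmetric adj;
  adj_irr : irreflexive adj }.

Definition edge_set (G : sgraph) : {set {set G}} :=
  [set [set x.1; x.2] | x : G * G & adj x.1 x.2].

Notation edge G := {e : {set vertex G} | e \in edge_set G}.

(* A signature is a map E(G) -> {+1, -1}, where b : bool stands for the sign
   (-1) ^ b: [true] is the sign -1 and [false] is the sign +1. *)
Notation signature G := {ffun edge G -> bool}.

Definition negative_edges (G : sgraph) (s : signature G) : {set edge G} :=
  [set e | s e].

Definition switch (G : sgraph) (u : G) (s : signature G) : signature G :=
  [ffun e : edge G => if u \in val e then ~~ s e else s e].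

(* [connect] is the reflexive transitive closure, so this relates s to the
   signatures obtained from it by a finite sequence of vertex switchings. *)
Definition switching_equivalent (G : sgraph) : rel (signature G) :=
  connect [rel s t : signature G | [exists u : G, t == switch u s]].

Definition graph_isomorphism (G H : sgraph) (f : {ffun G -> H}) : bool :=
  [&& injectiveb f, [forall y : H, y \in codom f]
    & [forall x : G, forall y : G, adj (f x) (f y) == adj x y]].

Definition preserves_signs (G H : sgraph) (s : signature G) (t : signature H)
    (f : {ffun G -> H}) : bool :=
  [forall e : edge G, forall e' : edge H,
     (val e' == f @: val e) ==> (t e' == s e)].

Definition signed_isomorphic (G H : sgraph) (s : signature G)
    (t : signature H) : bool :=
  [exists f : {ffun G -> H}, graph_isomorphism f && preserves_signs s t f].

Definition switching_isomorphic (G H : sgraph) (s : signature G)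
    (t : signature H) : bool :=
  [exists s' : signature G, switching_equivalent s s' && signed_isomorphic s' t].

(* [None] is the hub v and [Some i] is the rim vertex v_(i+1); [ordS] is the
   cyclic successor on 'I_n. The conjunct [i != j] only matters for n = 1,
   where it excludes a loop; the definition gives the usual wheel for n >= 3. *)
Definition wheel_adj (n : nat) : rel (option 'I_n) := fun x y =>
  match x, y with
  | None, None => false
  | None, Some _ | Some _, None => true
  | Some i, Some j => (i != j) && ((j == ordS i) || (i == ordS j))
  end.

Lemma wheel_adj_sym n : symmetric (@wheel_adj n).
Proof. by case=> [i|] [j|] //=; rewrite eq_sym orbC. Qed.

Lemma wheel_adj_irr n : irreflexive (@wheel_adj n).
Proof. by case=> [i|] //=; rewrite eqxx. Qed.

Definition wheel (n : nat) : sgraph :=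
  SGraph (@wheel_adj_sym n) (@wheel_adj_irr n).

Definition outer_cycle (n : nat) : {set edge (wheel n)} :=
  [set e | [exists i : 'I_n, val e == [set Some i; Some (ordS i)]]].

Definition outer_signed_wheels (n p : nat) : {set signature (wheel n)} :=
  [set s | (negative_edges s \subset outer_cycle n)
           && (#|negative_edges s| == p)].

Definition psi (p n : nat) : nat :=
  #|equivalence_partition (@switching_isomorphic (wheel n) (wheel n))
      (outer_signed_wheels n p)|.

(* [equivalence_partition] computes the set of classes only for an equivalence
   relation; [switching_isomorphic_equiv] below shows that it is one. *)

Lemma switchK (G : sgraph) (u : G) : involutive (switch u).
Proof.
by move=> s; apply/ffunP=> e; rewrite !ffunE; case: (u \in val e); rewrite ?negbK.
Qed.

Lemma switching_equivalent_sym (G : sgraph) (s t : signature G) :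
  switching_equivalent s t = switching_equivalent t s.
Proof.
apply: sym_connect_sym => {}s {}t /=.
by apply/existsP/existsP=> -[u /eqP->]; exists u; rewrite switchK.
Qed.

Lemma imset_edge (G H : sgraph) (f : {ffun G -> H}) (A : {set G}) :
  graph_isomorphism f -> A \in edge_set G -> f @: A \in edge_set H.
Proof.
case/and3P=> _ _ /forallP fadj /imsetP[[x y]]; rewrite inE /= => xy ->.
apply/imsetP; exists (f x, f y); last by rewrite imsetU !imset_set1.
by rewrite inE /= (eqP (forallP (fadj x) y)).
Qed.

Lemma signed_isomorphic_refl (G : sgraph) (s : signature G) :
  signed_isomorphic s s.
Proof.
have idE : [ffun x : G => x] =1 id by move=> x; rewrite ffunE.
apply/existsP; exists [ffun x => x]; apply/andP; split; first apply/and3P; first split.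
- by apply/injectiveP=> x y; rewrite !idE.
- by apply/forallP=> y; rewrite -{1}(idE y) codom_f.
- by apply/forallP=> x; apply/forallP=> y; rewrite !idE.
apply/forallP=> e; apply/forallP=> e'; apply/implyP.
by rewrite (eq_imset _ idE) imset_id => /eqP/val_inj->.
Qed.

Lemma signed_isomorphic_sym (G : sgraph) (s t : signature G) :
  signed_isomorphic s t -> signed_isomorphic t s.
Proof.
case/existsP=> f /andP[fiso /forallP fs].
have /and3P[/injectiveP finj _ /forallP fadj] := fiso.
pose g := [ffun y : G => invF finj y].
have fK : cancel f g by move=> x; rewrite ffunE invF_f.
have gK : cancel g f by move=> y; rewrite ffunE f_invF.
apply/existsP; exists g; apply/andP; split; first apply/and3P; first split.
- exact/injectiveP/(can_inj gK).
- by apply/forallP=> x; rewrite -(fK x) codom_f.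
- apply/forallP=> x; apply/forallP=> y.
  by rewrite -(eqP (forallP (fadj (g x)) (g y))) !gK.
apply/forallP=> e; apply/forallP=> e'; apply/implyP=> /eqP e'E.
have /implyP := forallP (fs e') e; rewrite e'E -imset_comp.
by rewrite (eq_imset _ (gK : f \o g =1 id)) imset_id eqxx => /(_ isT)/eqP->.
Qed.

Lemma signed_isomorphic_trans (G : sgraph) (s t r : signature G) :
  signed_isomorphic s t -> signed_isomorphic t r -> signed_isomorphic s r.
Proof.
case/existsP=> f /andP[fiso /forallP fs] /existsP[g /andP[giso /forallP gs]].
have /and3P[/injectiveP finj /forallP fsurj /forallP fadj] := fiso.
have /and3P[/injectiveP ginj /forallP gsurj /forallP gadj] := giso.
pose h := [ffun x => g (f x)].
have hE : h =1 g \o f by move=> x; rewrite ffunE.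
apply/existsP; exists h; apply/andP; split; first apply/and3P; first split.
- by apply/injectiveP=> x y; rewrite !hE => /ginj/finj.
- apply/forallP=> z; have /codomP[y ->] := gsurj z.
  by have /codomP[x ->] := fsurj y; rewrite -[g _]hE codom_f.
- apply/forallP=> x; apply/forallP=> y; rewrite !hE /=.
  by rewrite (eqP (forallP (gadj (f x)) (f y))) (eqP (forallP (fadj x) y)).
apply/forallP=> e; apply/forallP=> e2; apply/implyP.
rewrite (eq_imset _ hE) imset_comp => e2E.
pose e1 : edge G := Sub (f @: val e) (imset_edge fiso (valP e)).
rewrite (eqP (implyP (forallP (gs e1) e2) e2E)).
by rewrite (eqP (implyP (forallP (fs e) e1) (eqxx _))).
Qed.

Lemma signed_isomorphic_switch (G : sgraph) (s s' t : signature G) :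
    switching_equivalent s s' -> signed_isomorphic s t ->
  exists2 t', switching_equivalent t t' & signed_isomorphic s' t'.
Proof.
case/connectP=> p + ->; elim: p s t => [|s1 p IHp] s t /=.
  by move=> _ st; exists t; first exact: connect0.
case/andP=> /existsP[u /eqP->] sp /existsP[f /andP[fiso /forallP fs]].
have /and3P[/injectiveP finj _ _] := fiso.
have [||t' tt' st'] := IHp (switch u s) (switch (f u) t) => //.
  apply/existsP; exists f; rewrite fiso; apply/forallP=> e; apply/forallP=> e'.
  apply/implyP=> e'E; rewrite !ffunE (eqP (implyP (forallP (fs e) e') e'E)).
  by rewrite (eqP e'E) mem_imset.
exists t' => //; apply: connect_trans tt'; apply: connect1.
by apply/existsP; exists (f u).
Qed.

Lemma switching_isomorphic_equiv (G : sgraph) :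
  equivalence_rel (@switching_isomorphic G G).
Proof.
have Wrefl (s : signature G) : switching_isomorphic s s.
  by apply/existsP; exists s; rewrite signed_isomorphic_refl andbT; apply: connect0.
have Wsym (s t : signature G) :
    switching_isomorphic s t -> switching_isomorphic t s.
  case/existsP=> s' /andP[ss' s't].
  rewrite switching_equivalent_sym in ss'.
  have [t' tt' st'] := signed_isomorphic_switch ss' s't.
  by apply/existsP; exists t'; rewrite tt' signed_isomorphic_sym.
have Wtrans (s t r : signature G) :
    switching_isomorphic s t -> switching_isomorphic t r ->
    switching_isomorphic s r.
  case/existsP=> s' /andP[ss' s't] /existsP[t' /andP[tt' t'r]].
  have [s1 s's1 t's1] :=
    signed_isomorphic_switch tt' (signed_isomorphic_sym s't).
  apply/existsP; exists s1; rewrite [switching_equivalent _ _](connect_trans ss' s's1) /=.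
  exact: signed_isomorphic_trans (signed_isomorphic_sym t's1) t'r.
move=> s t r; split=> // st.
by apply/idP/idP; apply: Wtrans => //; apply: Wsym.
Qed.

(* Main.v *)
(* Both values are 1 for the same reason: the outer cycle has exactly n edges,
   so there is only one set of 0, respectively n, negative edges inside it. *)
Require Import Defs.
From mathcomp Require Import all_boot.

(** A signature is determined by its set of negative edges, so for [p = 0] or [p = n] only one
    signature is counted and there is a single class ([psi_eq1]). The case [p = n] rests on
    [card_outer_cycle]. *)

Lemma negative_edges_inj (G : sgraph) : injective (@negative_edges G).
Proof. by move=> s t /setP st; apply/ffunP=> e; have := st e; rewrite !inE. Qed.

Lemma ordS_neq (n : nat) (i : 'I_n) : 1 < n -> ordS i != i.
Proof.
move=> n_gt1; apply/negP=> /eqP/(congr1 val)/= iE.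
have : i + 1 == i + 0 %[mod n] by rewrite addn1 addn0 iE modn_small.
by rewrite eqn_modDl !modn_small // ltnW.
Qed.

Lemma ordS_ordS_neq (n : nat) (i : 'I_n) : 2 < n -> ordS (ordS i) != i.
Proof.
move=> n_gt2; apply/negP=> /eqP/(congr1 val)/= iE.
have : i + 2 == i + 0 %[mod n].
  by rewrite addn0 -[in X in _ == X]iE modn_mod -[_.+1 in X in _ == X]addn1 modnDml addn1 addn2.
by rewrite eqn_modDl !modn_small // ltnW // ltnW.
Qed.

Lemma rim_edge_in (n : nat) (i : 'I_n) : 1 < n ->
  [set Some i; Some (ordS i)] \in edge_set (wheel n).
Proof.
move=> n_gt1; apply/imsetP; exists (Some i, Some (ordS i)) => //.
by rewrite inE /= eq_sym ordS_neq // eqxx.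
Qed.

(** If two distinct indices gave the same edge, each would be the cyclic successor of the other,
    against [ordS_ordS_neq]. *)
Lemma rim_edge_inj (n : nat) : 2 < n ->
  injective (fun i : 'I_n => [set Some i; Some (ordS i)]).
Proof.
move=> n_gt2 i j /setP ijE.
have := ijE (Some i); rewrite !inE eqxx => /esym/orP[/eqP[//]|/eqP[iE]].
have := ijE (Some j); rewrite !inE eqxx => /orP[/eqP[//]|/eqP[jE]].
by have := ordS_ordS_neq n i n_gt2; rewrite -jE -iE eqxx.
Qed.

(** After [val] forgets the edge proofs, the outer cycle is the image of ['I_n] under the injection
    of [rim_edge_inj]. *)
Lemma card_outer_cycle (n : nat) : 2 < n -> #|outer_cycle n| = n.
Proof.
move=> n_gt2; rewrite -[RHS]card_ord -(card_imset _ val_inj).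
rewrite -(card_imset _ (rim_edge_inj n n_gt2)); apply: eq_card => A.
apply/imsetP/imsetP=> [[e] | [i _ ->]].
  by rewrite inE => /existsP[i /eqP eE] ->; exists i.
exists (exist (fun e => e \in edge_set (wheel n)) _ (rim_edge_in n i (ltnW n_gt2))) => //.
by rewrite inE; apply/existsP; exists i.
Qed.

(** If [A] is the only admissible negative edge set, its indicator is the only signature to
    classify, and a singleton has one class. *)
Lemma psi_eq1 (n p : nat) (A : {set edge (wheel n)}) :
  (forall B : {set edge (wheel n)},
     (B \subset outer_cycle n) && (#|B| == p) = (B == A)) ->
  psi p n = 1.
Proof.
move=> uniqA.
have negA : negative_edges (G := wheel n) [ffun e => e \in A] = A.
  by apply/setP=> e; rewrite inE ffunE.
rewrite /psi; suff -> : outer_signed_wheels n p = [set [ffun e => e \in A]].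
  by rewrite /equivalence_partition imset_set1 cards1.
by apply/setP=> s; rewrite !inE uniqA -{1}negA (inj_eq (negative_edges_inj _)).
Qed.

Theorem lemma3p1 (n : nat) (hn : 4 <= n) : psi 0 n = 1 /\ psi n n = 1.
Proof.
split.
  apply: (psi_eq1 n 0 set0) => B; rewrite cards_eq0.
  by case: eqP => [->|]; rewrite ?sub0set ?andbF.
apply: (psi_eq1 n n (outer_cycle n)) => B; rewrite eqEcard.
(* Inclusion already gives [#|B| <= n], so only the reverse inequality separates [#|B| = n] from
   what [eqEcard] asks. *)
rewrite (card_outer_cycle n (ltnW hn)); apply: andb_id2l => /subset_leq_card.
by rewrite (card_outer_cycle n (ltnW hn)) eqn_leq => ->.
Qed.
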